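(* Let $\mathbf E=(E,+,{}',0,1)$ be a lattice effect algebra with induced order $\leq$ and lattice operations $\vee,\wedge$, and put $x\rightarrow y:=y+(x\vee y)'$ for all $x,y\in E$. Then $(E,\rightarrow,0)$ is a lattice effect implication algebra, and for all $x,y\in E$: $x\leq y$ if and only if $x\rightarrow y=1$; $x\vee y=(x\rightarrow y)\rightarrow y$; and $x\wedge y=(x'\vee y')'$.
   Context: An effect algebra is a structure $(E,+,{}',0,1)$ where $E$ is a set, ${}'$ is a unary operation on $E$, $0,1\in E$, and $+$ is a partial binary operation on $E$ such that for all $x,y,z\in E$: (E1) if $x+y$ is defined then so is $y+x$ and $x+y=y+x$; (E2) $(x+y)+z$ is defined if and only if $x+(y+z)$ is defined, and then they are equal; (E3) $x+y$ is defined and equals $1$ if and only if $y=x'$; (E4) if $1+x$ is defined then $x=0$. The induced order is $x\leq y$ iff there exists $z$ with $x+z=y$. A lattice effect algebra is an effect algebra whose induced order is a lattice order. A lattice effect implication algebra is an algebra $(I,\rightarrow,0)$ with a binary operation $\rightarrow$ and a constant $0$ such that, writing $x':=x\rightarrow0$ and $1:=0'$, for all $x,y,z\in I$: (i) $0\rightarrow x=x\rightarrow x=x\rightarrow1=1$; (ii) if $x\rightarrow y=y\rightarrow x=1$ then $x=y$; (iii) if $x\rightarrow y=y\rightarrow z=1$ then $x\rightarrow z=1$; (iv) if $x\rightarrow y=1$ then $y'\rightarrow x'=1$; (v) $x''=x$; (vi) $x\rightarrow((x\rightarrow y)\rightarrow y)=1$; (vii) $y\rightarrow((x\rightarrow y)\rightarrow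 y)=1$; (viii) if $x\rightarrow z=y\rightarrow z=1$ then $((x\rightarrow y)\rightarrow y)\rightarrow z=1$; (ix) if $x\rightarrow y=1$ then $y\rightarrow x=x'\rightarrow y'$; (x) [$x\rightarrow y'=1$ and $(x'\rightarrow y)\rightarrow z'=1$] if and only if [$y\rightarrow z'=1$ and $x\rightarrow(y'\rightarrow z)'=1$], and in this case $(x'\rightarrow y)'\rightarrow z=x'\rightarrow(y'\rightarrow z)$; (xi) $y'\rightarrow((x\rightarrow y)\rightarrow y)'=x\rightarrow y$; (xii) $x\rightarrow(y\rightarrow x)=1$. *)

(* Defs.v *)
From mathcomp Require Import all_boot.

Set Implicit Arguments.
Unset Strict Implicit.
Unset Printing Implicit Defensive.

Section EffectAlgebra.

Variables (E : Type) (add : E -> E -> option E) (compl : E -> E) (zero one : E).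

(* The partial sum [x + y] is defined iff [add x y] is of the form [Some s].
   Since [obind] propagates undefinedness, the equality of options in
   [ea_addA] says that one side is defined iff the other one is, and that
   they are then equal. *)
Record is_effect_algebra : Prop := IsEffectAlgebra {
  ea_addC : forall x y s, add x y = Some s -> add y x = Some s;
  ea_addA : forall x y z,
    obind (fun s => add s z) (add x y) = obind (fun t => add x t) (add y z);
  ea_compl : forall x y, add x y = Some one <-> y = compl x;
  ea_one : forall x, isSome (add one x) -> x = zero
}.

Definition ea_le (x y : E) : Prop := exists z, add x z = Some y.

Definition is_join (x y j : E) : Prop :=
  [/\ ea_le x j, ea_le y j & forall z, ea_le x z -> ea_le y z -> ea_le j z].

Definition is_meet (x y m : E) : Prop :=
  [/\ ea_le m x, ea_le m y & forall z, ea_le z x -> ea_le z y -> ea_le z m].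

(* The effect algebra axioms make [ea_le] a partial order, so that it is a
   lattice order as soon as binary joins and meets exist; they are then unique
   and [join], [meet] are the lattice operations. *)
Record is_lattice_effect_algebra (join meet : E -> E -> E) : Prop :=
  IsLatticeEffectAlgebra {
  lea_effect_algebra : is_effect_algebra;
  lea_join : forall x y, is_join x y (join x y);
  lea_meet : forall x y, is_meet x y (meet x y)
}.

(* [y + (x \/ y)'], with the junk value [zero] where the sum is undefined. *)
Definition ea_imp (join : E -> E -> E) (x y : E) : E :=
  odflt zero (add y (compl (join x y))).

End EffectAlgebra.

Section ImplicationAlgebra.

Variables (I : Type) (imp : I -> I -> I) (zero : I).

Definition imp_neg (x : I) : I := imp x zero.

Definition imp_one : I := imp_neg zero.

Local Notation "x --> y" := (imp x y) (at level 55, no associativity).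
Local Notation "x ^c" := (imp_neg x) (at level 2, format "x ^c").
Local Notation "1" := imp_one.
Local Notation "0" := zero.

Record is_lattice_effect_implication_algebra : Prop :=
  IsLatticeEffectImplicationAlgebra {
  leia_bounds : forall x, [/\ 0 --> x = 1, x --> x = 1 & x --> 1 = 1];
  leia_antisym : forall x y, x --> y = 1 -> y --> x = 1 -> x = y;
  leia_trans : forall x y z, x --> y = 1 -> y --> z = 1 -> x --> z = 1;
  leia_contra : forall x y, x --> y = 1 -> y^c --> x^c = 1;
  leia_negK : forall x, x^c^c = x;
  leia_joinl : forall x y, x --> ((x --> y) --> y) = 1;
  leia_joinr : forall x y, y --> ((x --> y) --> y) = 1;
  leia_join_least : forall x y z,
    x --> z = 1 -> y --> z = 1 -> ((x --> y) --> y) --> z = 1;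
  leia_imp_neg : forall x y, x --> y = 1 -> y --> x = x^c --> y^c;
  leia_assoc_def : forall x y z,
    (x --> y^c = 1 /\ (x^c --> y) --> z^c = 1) <->
    (y --> z^c = 1 /\ x --> (y^c --> z)^c = 1);
  leia_assoc : forall x y z,
    x --> y^c = 1 -> (x^c --> y) --> z^c = 1 ->
    (x^c --> y)^c --> z = x^c --> (y^c --> z);
  leia_imp_join : forall x y, y^c --> ((x --> y) --> y)^c = x --> y;
  leia_weaken : forall x y, x --> (y --> x) = 1
}.

End ImplicationAlgebra.

(* Main.v *)
Require Import Defs.
From mathcomp Require Import all_boot.

Set Implicit Arguments.
Unset Strict Implicit.
Unset Printing Implicit Defensive.

(** In an effect algebra [x <= y] holds exactly when [x + y'] is defined.  As
    [y <= x \/ y], this makes [x --> y = y + (x \/ y)'] a total operation, with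
    [x --> y = 1] iff [x \/ y = y].  Since [y <= x --> y], cancellation gives
    [(x --> y) --> y = x \/ y].  Moreover [x' --> y = x + y] whenever [x + y]
    is defined, which turns axiom (x) into the associativity of [+]. *)

Section EffectAlgebraTheory.

Variables (E : Type) (add : E -> E -> option E) (compl : E -> E) (zero one : E).
Hypothesis EA : is_effect_algebra add compl zero one.

Local Notation le := (ea_le add).

Lemma add_compl x : add x (compl x) = Some one.
Proof. exact/(ea_compl EA). Qed.

Lemma add_eq_one x y : add x y = Some one -> y = compl x.
Proof. by move/(ea_compl EA). Qed.

Lemma complK x : compl (compl x) = x.
Proof. by rewrite -(add_eq_one (ea_addC EA (add_compl x))). Qed.

Lemma addA_l x y z s u : add x y = Some s -> add s z = Some u ->
  exists2 t, add y z = Some t & add x t = Some u.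
Proof.
move=> xy sz; have := ea_addA EA x y z; rewrite xy /= sz.
by case: (add y z) => //= t xt; exists t.
Qed.

Lemma addA_r x y z t u : add y z = Some t -> add x t = Some u ->
  exists2 s, add x y = Some s & add s z = Some u.
Proof.
move=> yz xt; have := ea_addA EA x y z; rewrite yz /= xt.
by case: (add x y) => //= s sz; exists s.
Qed.

Lemma compl_one : compl one = zero.
Proof. by apply: (ea_one EA); rewrite add_compl. Qed.

Lemma compl_zero : compl zero = one.
Proof. by rewrite -compl_one complK. Qed.

(** Reassociating [(x' + x) + 0 = 1 + 0 = 1] gives [x' + (x + 0) = 1], hence [x + 0 = x'' = x]. *)
Lemma addx0 x : add x zero = Some x.
Proof.
have := add_compl one; rewrite compl_one => one0.
have [t xt] := addA_l (ea_addC EA (add_compl x)) one0.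
by move/add_eq_one; rewrite complK xt => ->.
Qed.

Lemma add0x x : add zero x = Some x.
Proof. exact/(ea_addC EA)/addx0. Qed.

(** Both [y] and [z] complete [s' + x] to [one], so each is the complement of [s' + x]. *)
Lemma addI x y z s : add x y = Some s -> add x z = Some s -> y = z.
Proof.
move=> xy xz; have s's := ea_addC EA (add_compl s).
have [u us /add_eq_one ->] := addA_r xy s's.
have [v vs /add_eq_one ->] := addA_r xz s's.
by move: us; rewrite vs => -[->].
Qed.

Lemma leP x y : le x y <-> exists s, add x (compl y) = Some s.
Proof.
split=> [[z xz] | [s xy']].
  have [s ? _] := addA_l (ea_addC EA xz) (add_compl y).
  by exists s.
(* The witness is [(x + y')']: from [(y' + x) + s' = 1] follows [x + s' = y'' = y]. *)
have [t xs' /add_eq_one] := addA_l (ea_addC EA xy') (add_compl s).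
by rewrite complK => yt; exists (compl s); rewrite xs' yt.
Qed.

Lemma le_complP x y : le x (compl y) <-> exists s, add x y = Some s.
Proof. by have := leP x (compl y); rewrite complK. Qed.

Lemma le_refl x : le x x.
Proof. by exists zero; apply: addx0. Qed.

Lemma le0x x : le zero x.
Proof. by exists x; apply: add0x. Qed.

Lemma lex1 x : le x one.
Proof. by exists (compl x); apply: add_compl. Qed.

Lemma le_trans y x z : le x y -> le y z -> le x z.
Proof. by move=> [a xa] [b yb]; have [t _ xt] := addA_l xa yb; exists t. Qed.

Lemma le_anti x y : le x y -> le y x -> x = y.
Proof.
move=> [a xa] [b yb]; have [t ab xt] := addA_l xa yb.
(* Cancelling [x] in [x + (a + b) = x] leaves [a + b = 0]. Then [1 + (a + b)] is defined, hence so
   is [1 + a], and (E4) gives [a = 0]. *)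
have t0 := addI xt (addx0 x); rewrite t0 in ab.
have [u oneu _] := addA_r ab (addx0 one).
have a0 : a = zero by apply: (ea_one EA); rewrite oneu.
by move: xa; rewrite a0 addx0 => -[].
Qed.

Lemma le_compl x y : le x y -> le (compl y) (compl x).
Proof.
by move/leP=> [s xy']; apply/le_complP; exists s; apply: (ea_addC EA).
Qed.

Lemma le_compl_swap x y : le (compl x) y -> le (compl y) x.
Proof. by move/le_compl; rewrite complK. Qed.

End EffectAlgebraTheory.

Section LatticeEffectAlgebraTheory.

Variables (E : Type) (add : E -> E -> option E) (compl : E -> E) (zero one : E).
Variables (join meet : E -> E -> E).
Hypothesis LEA : is_lattice_effect_algebra add compl zero one join meet.

Let EA := lea_effect_algebra LEA.
Local Notation le := (ea_le add).
Local Notation imp := (ea_imp add compl zero join).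

Lemma le_joinl x y : le x (join x y).
Proof. by case: (lea_join LEA x y). Qed.

Lemma le_joinr x y : le y (join x y).
Proof. by case: (lea_join LEA x y). Qed.

Lemma join_least x y z : le x z -> le y z -> le (join x y) z.
Proof. by case: (lea_join LEA x y) => _ _; apply. Qed.

Lemma join_r x y : le x y -> join x y = y.
Proof.
move=> xy; apply: (le_anti EA); last exact: le_joinr.
exact: join_least xy (le_refl EA y).
Qed.

Lemma join_l x y : le y x -> join x y = x.
Proof.
move=> yx; apply: (le_anti EA); last exact: le_joinl.
exact: join_least (le_refl EA x) yx.
Qed.

(** The default value in [ea_imp] is never reached, because [y] lies below [join x y]. *)
Lemma imp_def x y : add y (compl (join x y)) = Some (imp x y).
Proof.
by rewrite /ea_imp; have /(leP EA)[s ->] := le_joinr x y.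
Qed.

Lemma impP x y : le x y <-> imp x y = one.
Proof.
split=> [xy | xy1].
  have := imp_def x y; rewrite join_r // (add_compl EA).
  by case.
have := imp_def x y; rewrite xy1 => /(add_eq_one EA) eq_compl.
by rewrite -(complK EA y) -eq_compl (complK EA); apply: le_joinl.
Qed.

(** Definedness of [x + y] means [y <= x'], so the join in [x' --> y] collapses to [x']. *)
Lemma imp_compl_add x y s : add x y = Some s -> imp (compl x) y = s.
Proof.
move=> xy; have yx := ea_addC EA xy; have := imp_def (compl x) y.
rewrite join_l; last by apply/(le_complP EA); exists s.
by rewrite (complK EA) yx => -[].
Qed.

Lemma imp_zero x : imp x zero = compl x.
Proof.
rewrite -{1}(complK EA x).
exact/imp_compl_add/(addx0 EA).
Qed.

Lemma le_imp x y : le y (imp x y).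
Proof. by exists (compl (join x y)); apply: imp_def. Qed.

(* [y + (x \/ y)' = x --> y] and [(x --> y) + (x --> y)' = 1], so that
   [(x \/ y)' + (y + (x --> y)') = 1]. *)
Lemma join_imp x y : join x y = imp (imp x y) y.
Proof.
have := imp_def (imp x y) y; rewrite join_l; last exact: le_imp.
have j'y := ea_addC EA (imp_def x y).
have [t -> /(add_eq_one EA)] :=
  addA_l EA j'y (add_compl EA (imp x y)).
by rewrite (complK EA) => -> [].
Qed.

(** De Morgan's law: complementation is an order-reversing involution. *)
Lemma meet_join x y : meet x y = compl (join (compl x) (compl y)).
Proof.
have [mx my m_max] := lea_meet LEA x y.
apply: (le_anti EA).
  rewrite -(complK EA (meet x y)); apply: (le_compl EA).
  by apply: join_least; apply: (le_compl EA).
apply: m_max; apply: (le_compl_swap EA).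
  exact: le_joinl.
exact: le_joinr.
Qed.

Lemma imp_negE x : imp_neg imp zero x = compl x.
Proof. exact: imp_zero. Qed.

Lemma imp_oneE : imp_one imp zero = one.
Proof. by rewrite /imp_one imp_negE; apply: (compl_zero EA). Qed.

Lemma lattice_effect_implication_algebra_of_lattice_effect_algebra :
  is_lattice_effect_implication_algebra imp zero.
Proof.
have leE x y : imp x y = one <-> le x y by split=> /impP.
(* In axiom (x), arrows into a complement express that a sum is defined. *)
have defE x y : imp x (compl y) = one <-> exists s, add x y = Some s.
  exact: iff_trans (leE _ _) (le_complP EA x y).
split=> [x|x y|x y z|x y|x|x y|x y|x y z|x y|x y z|x y z|x y|x y];
  rewrite ?imp_oneE ?imp_negE -?join_imp.
- split; apply/leE.
  + exact: (le0x EA x).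
  + exact: (le_refl EA x).
  + exact: (lex1 EA x).
- by move=> /leE xy /leE yx; apply: (le_anti EA xy yx).
- by move=> /leE xy /leE yz; apply/leE; apply: (le_trans EA xy yz).
- by move=> /leE xy; apply/leE; apply: (le_compl EA xy).
- exact: (complK EA x).
- exact/leE/le_joinl.
- exact/leE/le_joinr.
- by move=> /leE xz /leE yz; apply/leE/join_least.
(* Axiom (ix): both arrows equal the sum [x + y'], which exists as [x <= y]. *)
- move=> /leE /(leP EA) [s xy'].
  rewrite (imp_compl_add xy').
  rewrite -{1}(complK EA y).
  exact/imp_compl_add/(ea_addC EA).
(* The two sides say that [(x + y) + z], respectively [x + (y + z)], is defined. *)
- split=> -[/defE].
    move=> [s xy]; rewrite (imp_compl_add xy) => /defE[u sz].
    have [t yz xt] := addA_l EA xy sz.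
    by rewrite (imp_compl_add yz); split; apply/defE; [exists t | exists u].
  move=> [t yz]; rewrite (imp_compl_add yz) => /defE[u xt].
  have [s xy sz] := addA_r EA yz xt.
  by rewrite (imp_compl_add xy); split; apply/defE; [exists s | exists u].
- move=> /defE[s xy]; rewrite (imp_compl_add xy) => /defE[u sz].
  have [t yz xt] := addA_l EA xy sz.
  rewrite (imp_compl_add yz) (imp_compl_add xt).
  exact: imp_compl_add.
(* With the double arrow read as [join x y], axiom (xi) is the defining sum of [x --> y]. *)
- exact/imp_compl_add/imp_def.
- exact/leE/le_imp.
Qed.

End LatticeEffectAlgebraTheory.

Theorem theorem2p4 (E : Type) (add : E -> E -> option E) (compl : E -> E)
    (zero one : E) (join meet : E -> E -> E)
    (HE : is_lattice_effect_algebra add compl zero one join meet) :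
  let imp := ea_imp add compl zero join in
  (forall x y, add y (compl (join x y)) = Some (imp x y)) /\
  is_lattice_effect_implication_algebra imp zero /\
  (forall x y, ea_le add x y <-> imp x y = one) /\
  (forall x y, join x y = imp (imp x y) y) /\
  (forall x y, meet x y = compl (join (compl x) (compl y))).
Proof.
split; first exact: imp_def HE.
split; first exact: lattice_effect_implication_algebra_of_lattice_effect_algebra HE.
split; first exact: impP HE.
split; [exact: join_imp HE | exact: meet_join HE].
Qed.
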